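(* Let $n\geq 2$ and $d\geq 2$ be integers, and let $q$ be an arbitrary prime power. There exists a pencil $\mathcal{L}$ of degree $d$ hypersurfaces in $\mathbb{P}^n$ (defined over $\mathbb{F}_q$) such that every $\mathbb{F}_q$-member of $\mathcal{L}$ is nonblocking.
   Context: $\mathbb{F}_q$ is the finite field with $q$ elements. A degree $d$ hypersurface in $\mathbb{P}^n$ over $\mathbb{F}_q$ is given by the vanishing of a nonzero homogeneous polynomial of degree $d$ in $n+1$ variables $x_0,\dots,x_n$ with coefficients in $\mathbb{F}_q$. A pencil $\mathcal{L}=\langle F,G\rangle$ of degree $d$ hypersurfaces over $\mathbb{F}_q$ is the projective line (1-dimensional projective linear subspace) in the parameter space of degree $d$ hypersurfaces spanned by two linearly independent homogeneous forms $F,G$ of degree $d$ with coefficients in $\mathbb{F}_q$; its $\mathbb{F}_q$-members are the $q+1$ hypersurfaces $\{sF+tG=0\}$ for $[s:t]\in\mathbb{P}^1(\mathbb{F}_q)$. An $\mathbb{F}_q$-line is a line in $\mathbb{P}^n$ defined over $\mathbb{F}_q$. A hypersurface $X\subset\mathbb{P}^n$ over $\mathbb{F}_q$ is nonblocking (with respect to lines) if there exists an $\mathbb{F}_q$-line $L$ such that $X\cap L$ has no $\mathbb{F}_q$-points. *)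

(* Defs.v *)
From HB Require Import structures.
From mathcomp Require Import all_boot all_order all_algebra.
From mathcomp.multinomials Require Export mpoly.
Set Implicit Arguments.
Unset Strict Implicit.
Unset Printing Implicit Defensive.
Import GRing.Theory.
Local Open Scope ring_scope.

(* Degree d forms in x_0, ..., x_n; the nonzero ones define the degree d
   hypersurfaces of P^n over F. *)
Notation hform F n d := (dhomog n.+1 F d).

(* An F-line of P^n is a 2-dimensional subspace of F^(n+1). *)
Definition Fline (F : finFieldType) (n : nat) (L : {vspace 'rV[F]_n.+1}) : Prop :=
  \dim L = 2%N.

(* v is a nonzero vector of homogeneous coordinates of an F-point of the
   intersection of {f = 0} with L; the condition is invariant under rescaling v or f. *)
Definition Fpoint_on (F : finFieldType) (n d : nat) (f : hform F n d)
    (L : {vspace 'rV[F]_n.+1}) (v : 'rV[F]_n.+1) : Prop :=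
  [/\ v != 0, v \in L & (f : {mpoly F[n.+1]}).@[v 0] = 0].

Definition nonblocking (F : finFieldType) (n d : nat) (f : hform F n d) : Prop :=
  exists L : {vspace 'rV[F]_n.+1},
    Fline L /\ ~ (exists v : 'rV[F]_n.+1, Fpoint_on f L v).

(* f and g span a pencil when f and g are linearly independent; every
   member below is then a nonzero form. *)
Definition pencil (F : finFieldType) (n d : nat) (f g : hform F n d) : Prop :=
  free [:: f; g].

(* h defines the member of <f, g> at some [s : t] in P^1(F). *)
Definition pencil_member (F : finFieldType) (n d : nat) (f g h : hform F n d) : Prop :=
  exists s t : F, (s, t) != (0, 0) /\ h = s *: f + t *: g.

(* Main.v *)
Require Import Defs.
From mathcomp Require Import all_boot all_order all_algebra.
From mathcomp Require Import ring.
Import GRing.Theory.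
Local Open Scope ring_scope.

(** All lines used have the form z = al x + be y in the plane of the first
    three coordinates x, y, z. A self-map of F taking the same value twice is
    not surjective; applied to p |-> p - p^m, which vanishes at 0 and 1, this
    gives for every m >= 2 a form A_m = x^m - x y^(m-1) + a_m y^m without
    nontrivial zeros.

    If d >= 3 and |F| > 2, take f = z A_(d-1) + (x - y) x y^(d-2) and g = A_d.
    A member f + c g is linear in z with nowhere vanishing leading coefficient,
    so over the affine line y = 1 it is the graph of a function v. A line of
    slope al misses this graph for a suitable intercept as soon as al is the
    slope of some chord of v, and it misses the point at infinity when
    al <> -c. For c <> 0 the chord over 0, 1 has slope 0; for c = 0 the chord
    over 0, w with w <> 0, 1 has nonzero slope.

    If d = 2 or |F| = 2, then u^(d-1) = u on F, and the pencil of
    f = z x^(d-1) + a y^d and g = z y^(d-1) + x^d - y^d takes the values of a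
    pencil of conics linear in z. Since c^3 - c + a has no root, the two
    remaining parameters of the line can be chosen so that the member f + c g
    restricts to a nonzero multiple of A_2. *)

Lemma missed_value (F : finType) (f : F -> F) (p q : F) :
  p != q -> f p = f q -> exists b, forall u, f u != b.
Proof.
move=> npq fpq; have [/injectiveP finj | ninj] := boolP (injectiveb f).
  by rewrite (finj _ _ fpq) eqxx in npq.
have [/existsP[b /forallP nb] | /existsPn onto] :=
  boolP [exists b, forall u, f u != b]; first by exists b.
have sur b : exists u, b == f u.
  by have /forallPn[u /negPn/eqP <-] := onto b; exists u.
(* If [f] is onto, its section [g] is injective, hence bijective by finiteness, so [f] is its
   inverse and injective. *)
case/injectiveP: ninj; pose g b := xchoose (sur b).
have gK : cancel g f by move=> b; rewrite -(eqP (xchooseP (sur b))).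
exact: can_inj (canF_sym gK).
Qed.

Lemma rootless_trinomial (F : finFieldType) (m : nat) :
  (2 <= m)%N -> exists a : F, forall p : F, p ^+ m - p + a != 0.
Proof.
case: m => [|[|m]] // _.
have n01 : (0 : F) != 1 by rewrite eq_sym oner_eq0.
have E01 : (0 : F) - 0 ^+ m.+2 = 1 - 1 ^+ m.+2.
  by rewrite expr0n expr1n /= !subrr.
have [a na] := missed_value F (fun p => p - p ^+ m.+2) 0 1 n01 E01.
exists a => p; apply: contra (na p) => /eqP E.
by rewrite -subr_eq0 -oppr_eq0 -[X in _ == X]E; apply/eqP; ring.
Qed.

Lemma meval_homogZ (R : comNzRingType) (n d : nat) (f : {mpoly R[n]}) (c : R)
    (v w : 'I_n -> R) :
  f \is d.-homog -> (forall i, w i = c * v i) -> f.@[w] = c ^+ d * f.@[v].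
Proof.
move=> /dhomogP hf wE; rewrite !mevalE mulr_sumr big_seq [RHS]big_seq.
apply: eq_bigr => m /hf <-; rewrite mulrCA; congr (_ * _).
rewrite /= mdegE -prodrXr -big_split /=.
by apply: eq_bigr => i _; rewrite wE exprMn.
Qed.

(** Coordinates from index 3 on are 0, the default of [nth], so one plane serves every n >= 2. *)
Definition plane_pt (R : pzRingType) (n : nat) (x y z : R) : 'I_n -> R :=
  fun i => [:: x; y; z]`_i.

(** Up to scaling, a point of the line z = al x + be y either has y = 1 or is (1 : 0 : al). *)
Lemma nonblocking_line (F : finFieldType) (m d : nat) (h : hform F m.+2 d)
    (al be : F) :
    (h : {mpoly F[m.+3]}).@[plane_pt F m.+3 1 0 al] != 0 ->
    (forall p, (h : {mpoly F[m.+3]}).@[plane_pt F m.+3 p 1 (al * p + be)] != 0) ->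
  nonblocking h.
Proof.
move=> hinf haff.
pose u : 'rV[F]_m.+3 := \row_i plane_pt F m.+3 1 0 al i.
pose w : 'rV[F]_m.+3 := \row_i plane_pt F m.+3 0 1 be i.
exists <<[:: u; w]>>%VS; split.
  apply/eqP; rewrite -[_ == _]/(free [:: u; w]).
  rewrite free_cons seq1_free span_seq1; apply/andP; split.
    apply/negP=> /vlineP[k /rowP/(_ ord0)]; rewrite !mxE /plane_pt /= mulr0.
    by move/eqP; rewrite oner_eq0.
  apply/negP=> /eqP/rowP/(_ (inord 1)); rewrite !mxE /plane_pt inordK //=.
  by move/eqP; rewrite oner_eq0.
case=> v []; rewrite span_cons span_seq1.
move=> vn0 /memv_addP[_ /vlineP[x ->] [_ /vlineP[y ->] vE]] h0.
have vi i : v 0 i = plane_pt F m.+3 x y (al * x + be * y) i.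
  rewrite vE !mxE /plane_pt.
  by case: i => [[|[|[|i]]] Hi] /=; rewrite ?nth_nil; ring.
have hh := dhomog_is_dhomog h.
have [y0 | yn0] := eqVneq y 0.
  have vx i : v 0 i = x * plane_pt F m.+3 1 0 al i.
    by rewrite vi y0 /plane_pt; case: i => [[|[|[|i]]] Hi] /=; rewrite ?nth_nil; ring.
  move: h0 hinf; rewrite (meval_homogZ _ _ _ _ _ _ _ hh vx).
  have xn0 : x != 0.
    by apply: contraNneq vn0 => x0; apply/eqP/rowP=> i; rewrite vx x0 mul0r mxE.
  by move/eqP; rewrite mulf_eq0 expf_eq0 (negPf xn0) andbF /= => ->.
have vx i : v 0 i = y * plane_pt F m.+3 (x / y) 1 (al * (x / y) + be) i.
  by rewrite vi /plane_pt; case: i => [[|[|[|i]]] Hi] /=; rewrite ?nth_nil; field.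
move: h0 (haff (x / y)); rewrite (meval_homogZ _ _ _ _ _ _ _ hh vx).
by move/eqP; rewrite mulf_eq0 expf_eq0 (negPf yn0) andbF /= => ->.
Qed.

Lemma meval_hformZ (F : finFieldType) (n d : nat) (c : F) (h : hform F n d) v :
  (mpoly_of_dhomog (c *: h)).@[v] = c * (mpoly_of_dhomog h).@[v].
Proof. by rewrite -mevalZ. Qed.

Lemma meval_hformD (F : finFieldType) (n d : nat) (f g : hform F n d) v :
  (mpoly_of_dhomog (f + g)).@[v] =
    (mpoly_of_dhomog f).@[v] + (mpoly_of_dhomog g).@[v].
Proof. by rewrite -mevalD. Qed.

Lemma nonblockingZ (F : finFieldType) (n d : nat) (h : hform F n d) (c : F) :
  c != 0 -> nonblocking h -> nonblocking (c *: h).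
Proof.
move=> cn0 [L [dL nL]]; exists L; split=> // -[v [vn0 vL hv]].
apply: nL; exists v; split=> //; move/eqP: hv.
by rewrite meval_hformZ mulf_eq0 (negPf cn0) => /eqP.
Qed.

Lemma nonblocking_neq0 (F : finFieldType) (n d : nat) (h : hform F n d) :
  nonblocking h -> h != 0.
Proof.
move=> [L [dL nL]]; apply/eqP=> h0; apply: nL; exists (vpick L).
split; rewrite ?memv_pick ?vpick0 -?dimv_eq0 ?dL //.
by rewrite h0 -(scale0r 0) meval_hformZ mul0r.
Qed.

(** A linear dependence would make [g] or some [f + c *: g] zero, and the zero form vanishes on
    every line. *)
Lemma nonblocking_pencil (F : finFieldType) (n d : nat) (f g : hform F n d) :
    nonblocking g -> (forall c, nonblocking (f + c *: g)) ->
  pencil f g /\ forall h : hform F n d, pencil_member f g h -> nonblocking h.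
Proof.
move=> nbg nbf; split.
  rewrite /pencil free_cons seq1_free (nonblocking_neq0 _ _ _ _ nbg) andbT.
  rewrite span_seq1; apply/negP=> /vlineP[k fE].
  by have /nonblocking_neq0 := nbf (- k); rewrite fE scaleNr subrr eqxx.
move=> h [s [t [stn0 ->]]]; have [s0 | sn0] := eqVneq s 0.
  rewrite s0 scale0r add0r; apply: nonblockingZ nbg.
  by apply: contraNneq stn0 => t0; rewrite s0 t0.
have -> : s *: f + t *: g = s *: (f + (t / s) *: g).
  by rewrite scalerDr scalerA mulrCA divff // mulr1.
exact: nonblockingZ.
Qed.

Section PlaneForms.

Variables (F : finFieldType) (m : nat).

Notation X := ('X_ord0 : {mpoly F[m.+3]}).
Notation Y := ('X_(inord 1) : {mpoly F[m.+3]}).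
Notation Z := ('X_(inord 2) : {mpoly F[m.+3]}).
Notation pt := (plane_pt F m.+3).

Lemma meval_plane_pt x y z :
  (X.@[pt x y z] = x) * (Y.@[pt x y z] = y) * (Z.@[pt x y z] = z).
Proof. by rewrite !mevalXU /plane_pt !inordK. Qed.

Lemma dhomogXU i : ('X_i : {mpoly F[m.+3]}) \is 1.-homog.
Proof. by rewrite dhomogX /= mdeg1. Qed.

Lemma dhomogXUn i k : ('X_i ^+ k : {mpoly F[m.+3]}) \is k.-homog.
Proof. by rewrite -[X in X.-homog]mul1n; apply/dhomogMn/dhomogXU. Qed.

(** This is A_(k+1); indexing by [k] avoids a truncated subtraction in the exponent of y. *)
Definition anisotropic_form k (a : F) : {mpoly F[m.+3]} :=
  X ^+ k.+1 - X * Y ^+ k + a *: Y ^+ k.+1.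

Lemma dhomog_anisotropic k a : anisotropic_form k a \is k.+1.-homog.
Proof.
rewrite /anisotropic_form rpredD ?rpredB ?rpredZ ?dhomogXUn //.
exact: dhomogM (dhomogXU _) (dhomogXUn _ _).
Qed.

Lemma meval_anisotropic k a x y z :
  (anisotropic_form k a).@[pt x y z] = x ^+ k.+1 - x * y ^+ k + a * y ^+ k.+1.
Proof.
by rewrite mevalD mevalB mevalZ mevalM !rmorphXn /= !meval_plane_pt.
Qed.

Lemma big_pencil k (w : F) : w != 0 -> w != 1 ->
  exists f g : hform F m.+2 k.+3,
    nonblocking g /\ forall c, nonblocking (f + c *: g).
Proof.
move=> wn0 wn1.
have [a na] := rootless_trinomial F k.+2 isT.
have [b nb] := rootless_trinomial F k.+3 isT.
have hf : Z * anisotropic_form k.+1 a + (X - Y) * (X * Y ^+ k.+1) \is k.+3.-homog.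
  apply: rpredD; first exact: dhomogM (dhomogXU _) (dhomog_anisotropic _ _).
  apply: (@dhomogM _ _ _ 1%N _ k.+2); first by rewrite rpredB ?dhomogXU.
  exact: dhomogM (dhomogXU _) (dhomogXUn _ _).
exists (DHomog hf), (DHomog (dhomog_anisotropic k.+2 b)); split.
  apply: (nonblocking_line _ _ _ _ 0 0) => [|p]; rewrite /= meval_anisotropic.
    by rewrite !expr1n !expr0n /= !mulr0 subr0 addr0 oner_neq0.
  by rewrite !expr1n !mulr1 nb.
move=> c.
(* At (p, 1, z) the member is z [H p] + [K p], so v = - K / H; at (1, 0, al) it is al + c. *)
pose H (p : F) := p ^+ k.+2 - p + a.
pose K (p : F) := p * (p - 1) + c * (p ^+ k.+3 - p + b).
suff [al [nal [p [q [npq Epq]]]]] : exists al, al + c != 0 /\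
    exists p q, p != q /\ - al * p - K p / H p = - al * q - K q / H q.
  have [be nbe] := missed_value _ (fun p => - al * p - K p / H p) _ _ npq Epq.
  apply: (nonblocking_line _ _ _ _ al be) => [|u].
    rewrite meval_hformD meval_hformZ /= mevalD !mevalM !meval_anisotropic.
    rewrite rmorphXn /= !meval_plane_pt !expr1n !expr0n /=.
    by rewrite !(mulr0, mul0r, subr0, addr0, mulr1).
  rewrite meval_hformD meval_hformZ /= mevalD !mevalM !meval_anisotropic.
  rewrite mevalB rmorphXn /= !meval_plane_pt !expr1n !mulr1.
  apply: contra (nbe u) => /eqP E; have Hn0 : H u != 0 by apply: na.
  rewrite -subr_eq0; apply/eqP/(mulIf Hn0).
  rewrite mul0r -[RHS]oppr0 -E mulrBl mulrBl divfK // /H /K.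
  by ring.
have [c0 | cn0] := eqVneq c 0.
  have Hn0 : H w != 0 by apply: na.
  (* Slope of the chord of v over 0, w: here [K 0] = 0 and [K w] = w (w - 1). *)
  exists ((1 - w) / H w); split.
    by rewrite c0 addr0 mulf_neq0 ?invr_eq0 // subr_eq0 eq_sym.
  exists 0, w; split; first by rewrite eq_sym.
  by rewrite /K c0; field; rewrite Hn0 na.
(* At both 0 and 1, [H] equals a and [K] equals c b. *)
exists 0; rewrite add0r; split=> //; exists 0, 1.
rewrite eq_sym oner_eq0; split=> //.
by rewrite /K /H !expr0n !expr1n /=; congr (_ - _ / _); ring.
Qed.

Lemma small_pencil e : (forall u : F, u ^+ e = u) ->
  exists f g : hform F m.+2 e.+1,
    nonblocking g /\ forall c, nonblocking (f + c *: g).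
Proof.
move=> expe.
have [a na] := rootless_trinomial F 3 isT.
have [b nb] := rootless_trinomial F 2 isT.
have hf : Z * X ^+ e + a *: Y ^+ e.+1 \is e.+1.-homog.
  rewrite rpredD ?rpredZ ?dhomogXUn //.
  exact: dhomogM (dhomogXU _) (dhomogXUn _ _).
have hg : Z * Y ^+ e + X ^+ e.+1 - Y ^+ e.+1 \is e.+1.-homog.
  rewrite rpredB ?rpredD ?dhomogXUn //.
  exact: dhomogM (dhomogXU _) (dhomogXUn _ _).
have evf x y z :
    (Z * X ^+ e + a *: Y ^+ e.+1).@[pt x y z] = z * x + a * y ^+ 2.
  by rewrite mevalD mevalZ mevalM !rmorphXn /= !meval_plane_pt !exprS !expe expr0 mulr1.
have evg x y z :
    (Z * Y ^+ e + X ^+ e.+1 - Y ^+ e.+1).@[pt x y z] = z * y + x ^+ 2 - y ^+ 2.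
  rewrite mevalB mevalD mevalM !rmorphXn /= !meval_plane_pt.
  by rewrite !exprS !expe !expr0 !mulr1.
exists (DHomog hf), (DHomog hg); split.
  (* On this line g becomes x^2 - x y + b y^2. *)
  apply: (nonblocking_line _ _ _ _ (-1) (b + 1)) => [|p]; rewrite /= evg.
    by rewrite mulr0 add0r expr1n expr0n subr0 oner_neq0.
  by apply: contra (nb p) => /eqP E; rewrite -E; apply/eqP; ring.
(* The member is z (x + c y) + a y^2 + c (x^2 - y^2). Where x = - c y it equals k y^2 on any line;
   the slope and intercept then adjust the other two coefficients. *)
move=> c; set k := c ^+ 3 - c + a.
have kn0 : k != 0 by apply: na.
(* On the line below, f + c g becomes k (y^2 - y t + b t^2) with t = x + c y. *)
apply: (nonblocking_line _ _ _ _ (k * b - c) (c ^+ 2 - k + k * b * c)) => [|p].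
  rewrite meval_hformD meval_hformZ /= evf evg.
  have := nb 0; rewrite expr0n subr0 add0r => bn0.
  by rewrite !(mulr0, mulr1, expr0n, expr1n, add0r, subr0, addr0) subrK mulf_neq0.
rewrite (meval_hformD F m.+2) meval_hformZ /= evf evg.
have -> : forall z, z * p + a * 1 ^+ 2 + c * (z * 1 + p ^+ 2 - 1 ^+ 2) =
  (p + c) * z + a + c * (p ^+ 2 - 1) by move=> z; ring.
have -> : (p + c) * ((k * b - c) * p + (c ^+ 2 - k + k * b * c)) + a +
    c * (p ^+ 2 - 1) = k * (1 - (p + c) + b * (p + c) ^+ 2).
  by rewrite /k; ring.
rewrite mulf_neq0 //; have [-> | tn0] := eqVneq (p + c) 0.
  by rewrite expr0n mulr0 addr0 subr0 oner_neq0.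
(* For t = p + c nonzero, 1 - t + b t^2 is t^2 times u^2 - u + b at u = 1 / t. *)
apply: contra (nb (p + c)^-1) => /eqP E.
by rewrite -(mulr0 ((p + c)^-1 ^+ 2)) -E; apply/eqP; field.
Qed.

End PlaneForms.

Theorem theorem1p1 (n d : nat) (F : finFieldType) (hn : (2 <= n)%N) (hd : (2 <= d)%N) :
  exists f g : hform F n d,
    pencil f g /\ forall h : hform F n d, pencil_member f g h -> nonblocking h.
Proof.
suff [f [g [nbg nbf]]] : exists f g : hform F n d,
    nonblocking g /\ forall c, nonblocking (f + c *: g).
  by exists f, g; apply: nonblocking_pencil.
case: n hn => [|[|m]] // _; case: d hd => [|[|[|k]]] // _.
  by apply: small_pencil => u; rewrite expr1.
(* Now d >= 3; if no such [w] exists, every element is 0 or 1 and equals its positive powers. *)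
have [/existsP[w /andP[wn0 wn1]] | /existsPn F2] :=
  boolP [exists w : F, (w != 0) && (w != 1)]; first exact: (big_pencil _ _ _ w).
apply: small_pencil => u; have := F2 u; rewrite negb_and !negbK.
by case/orP=> /eqP->; rewrite ?expr0n ?expr1n.
Qed.
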